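(* Let $M \subseteq \mathbb{N}$ be a numerical semigroup with gaps list $G_M$ and let $n \in \mathbb{N}$. Then for every $x \in \mathbb{N}$, $x$ occurs in the list $\mathrm{apery}(G_M, n)$ if and only if $x \in M$ and ($n \le x$ implies $x - n \notin M$).
   Context: A numerical semigroup is a submonoid $M$ of $(\mathbb{N},+)$ with $\mathbb{N}\setminus M$ finite; its gaps list $G_M$ is the list of the elements of $\mathbb{N}\setminus M$ in strictly ascending order. All numbers are natural numbers. For a list $G$ of natural numbers and $n \in \mathbb{N}$, let $L = [0;1;\dots;n-1]$ and let $T$ be the list obtained by adding $n$ to every element of $G$; then $\mathrm{apery}(G,n)$ is the list obtained from the concatenation $L\,T$ by removing all elements that occur in $G$. The set $\{x \in M \mid n \le x \rightarrow x-n \notin M\}$ is (the natural-number version of) the Apéry set of $M$ with respect to $n$. *)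

(* Defs.v *)
From mathcomp Require Import all_boot.
From mathcomp Require Import boolp classical_sets functions cardinality.

Set Implicit Arguments.
Unset Strict Implicit.
Unset Printing Implicit Defensive.

Local Open Scope classical_set_scope.

Definition numerical_semigroup (M : set nat) : Prop :=
  [/\ M 0,
      forall x y, M x -> M y -> M (x + y)
    & finite_set (~` M)].

(* The gaps list is characterised rather than computed; it exists and is unique
   as soon as [~` M] is finite, see [gaps_list_exists] and [gaps_list_uniq]. *)
Definition is_gaps_list (M : set nat) (G : seq nat) : Prop :=
  sorted ltn G /\ forall x, x \in G <-> ~ M x.

Definition apery (G : seq nat) (n : nat) : seq nat :=
  [seq x <- iota 0 n ++ [seq g + n | g <- G] | x \notin G].

Lemma gaps_list_exists (M : set nat) :
  numerical_semigroup M -> exists G, is_gaps_list M G.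
Proof.
case=> _ _ /finite_seqP[s Ms]; exists (sort leq (undup s)); split.
  by rewrite ltn_sorted_uniq_leq sort_uniq undup_uniq sort_sorted //; exact: leq_total.
move=> x; rewrite mem_sort mem_undup.
by have -> : (~ M x) = (~` M) x by []; rewrite Ms.
Qed.

Lemma gaps_list_uniq (M : set nat) (G H : seq nat) :
  is_gaps_list M G -> is_gaps_list M H -> G = H.
Proof.
move=> [sG GP] [sH HP]; apply: (irr_sorted_eq ltn_trans ltnn sG sH) => x.
by apply/idP/idP => [/GP/HP|/HP/GP].
Qed.

(* Main.v *)
Require Import Defs.
From mathcomp Require Import all_boot.
From mathcomp Require Import boolp.
From mathcomp Require Import classical_sets.

(** Filtering out the gaps leaves exactly the candidates lying in [M]. If [x < n], then [x] is in
    [iota 0 n] and the condition on [x - n] is vacuous. If [n <= x], only the shifted list can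
    contain [x], and it does exactly when [x - n] is a gap. *)

Theorem theorem2 (M : set nat) (hM : numerical_semigroup M)
    (G : seq nat) (hG : is_gaps_list M G) (n x : nat) :
  x \in apery G n <-> M x /\ (n <= x -> ~ M (x - n)).
Proof.
case: hG => _ GP.
have notinG y : y \notin G <-> M y.
  (* Membership in [M] need not be decidable: not being a gap only gives [~ ~ M y], hence the
     classical [contrapT]. *)
  split=> [/negP yG|My]; first by apply: contrapT => /GP.
  by apply/negP => /GP.
rewrite /apery mem_filter mem_cat mem_iota add0n leq0n /=.
split=> [/andP[/notinG Mx xLT]|[Mx xn]].
  split=> // le_nx; move: xLT; rewrite ltnNge le_nx /=.
  by case/mapP=> g /GP Mg ->; rewrite addnK.
apply/andP; split; first exact/notinG.
have [//|le_nx] := ltnP x n.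
by apply/mapP; exists (x - n); [apply/GP/xn | rewrite subnK].
Qed.
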